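(* Let $k$ be a field with $\mathrm{char}(k)\neq 2$, let $(A,\ast)$ be a $k$-algebra with involution, and let $l=k(\eta)$ be a quadratic field extension of $k$ whose nontrivial Galois automorphism is $\eta\mapsto-\eta$. Let $\tau:l\otimes A\to A\otimes l$ be the twisting map induced by a pair $(f,\delta)$. Then the involution of $A$ lifts in a compatible way to an involution of $A\otimes_{(f,\delta)}l$ if, and only if, $$f\circ\overline{f}=\mathrm{Id}_A\qquad\text{and}\qquad \delta\circ\overline{f}=\overline{\delta}.$$
   Context: All algebras are unital associative $k$-algebras, all maps are $k$-linear, $\otimes=\otimes_k$. An involution on an algebra is a $k$-linear antimultiplicative map whose square is the identity. For a linear endomorphism $\varphi$ of $A$, its conjugate is $\overline{\varphi}(a):=\varphi(a^\ast)^\ast$. The field $l$ is equipped with the involution $\eta\mapsto-\eta$. For algebras $A,B$ a twisting map is a linear map $\tau:B\otimes A\to A\otimes B$ with $\tau\circ(B\otimes\mu_A)=(\mu_A\otimes B)\circ(A\otimes\tau)\circ(\tau\otimes A)$, $\tau\circ(\mu_B\otimes A)=(A\otimes\mu_B)\circ(\tau\otimes B)\circ(B\otimes\tau)$, $\tau(1\otimes a)=a\otimes1$, $\tau(b\otimes1)=1\otimes b$; the twisted tensor product $A\otimes_\tau B$ is $A\otimes B$ with product $(\mu_A\otimes\mu_B)\circ(A\otimes\tau\otimes B)$. A twisting map $\tau:l\otimes A\to A\otimes l$ is induced by a pair $(f,\delta)$, where $f$ is a (unital) algebra endomorphism of $A$ and $\delta$ is a left $f$-derivation ($\delta(ab)=\delta(a)b+f(a)\delta(b)$),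 through $\tau(\eta\otimes a)=\delta(a)\otimes1+f(a)\otimes\eta$; one writes $A\otimes_{(f,\delta)}l:=A\otimes_\tau l$. (If $p(x)=x^2-\alpha x+\beta$ is the minimal polynomial of $\eta$, so here $\alpha=0$, such pairs are those with $\delta^2-\alpha\delta+\beta\,\mathrm{id}_A=\beta f^2$ and $f\delta+\delta f=\alpha(f-f^2)$.) The involution of $A$ lifts in a compatible way if there is an involution $j$ on $A\otimes_{(f,\delta)}l$ with $j(a\otimes1)=a^\ast\otimes1$ for all $a\in A$ and $j(1\otimes z)=1\otimes\bar z$ for all $z\in l$, where $\bar z$ is the image of $z$ under $\eta\mapsto-\eta$; necessarily $j(a\otimes z)=\tau(\bar z\otimes a^\ast)$. *)

(* Defs.v *)
From HB Require Import structures.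
From mathcomp Require Import all_boot all_order all_algebra all_field.
From mathcomp Require Import boolp.

Set Implicit Arguments.
Unset Strict Implicit.
Unset Printing Implicit Defensive.

Import GRing.Theory.
Local Open Scope ring_scope.
Local Open Scope quotient_scope.

(* Tensor product of k-modules: formal sums of pairs (u, v), represented as   *)
(* sequences, modulo having the same image under every bilinear map. As the   *)
(* relation is a Prop, the quotient is itself an lmodType k in the universe   *)
(* quantified over; tlift_tpure and tlift_unique state that it has the        *)
(* universal property characterizing the tensor product.                      *)
Section Tensor.
Variables (k : fieldType) (U V : lmodType k).
Implicit Types (W : lmodType k) (s t : seq (U * V)).

Definition eval_sum W (b : U -> V -> W) s : W := \sum_(p <- s) b p.1 p.2.

Definition same_tensor s t : bool :=
  `[< forall W (b : {bilinear U -> V -> W}), eval_sum b s = eval_sum b t >].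

Lemma same_tensor_refl : reflexive same_tensor.
Proof. by move=> s; apply/asboolP. Qed.

Lemma same_tensor_sym : symmetric same_tensor.
Proof.
by move=> s t; apply/asboolP/asboolP => st W b; rewrite st.
Qed.

Lemma same_tensor_trans : transitive same_tensor.
Proof.
by move=> t s u /asboolP st /asboolP tu; apply/asboolP => W b; rewrite st tu.
Qed.

Canonical same_tensor_equiv :=
  EquivRel same_tensor same_tensor_refl same_tensor_sym same_tensor_trans.

Definition tensor : Type := {eq_quot same_tensor}.
HB.instance Definition _ := Choice.on tensor.
HB.instance Definition _ := EqQuotient.on tensor.

Definition scale_seq (c : k) s := [seq (c *: p.1, p.2) | p <- s].

Definition tensor_zero : tensor := \pi_tensor [::].
Definition tensor_add (x y : tensor) : tensor := \pi_tensor (repr x ++ repr y).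
Definition tensor_scale (c : k) (x : tensor) : tensor :=
  \pi_tensor (scale_seq c (repr x)).
Definition tensor_opp (x : tensor) : tensor := tensor_scale (-1) x.
Definition tpure (u : U) (v : V) : tensor := \pi_tensor [:: (u, v)].
Definition tlift W (b : {bilinear U -> V -> W}) (x : tensor) : W :=
  eval_sum b (repr x).

Lemma eval_cat W (b : U -> V -> W) s t :
  eval_sum b (s ++ t) = eval_sum b s + eval_sum b t.
Proof. by rewrite /eval_sum big_cat. Qed.

Lemma eval_scale W (b : {bilinear U -> V -> W}) c s :
  eval_sum b (scale_seq c s) = c *: eval_sum b s.
Proof.
rewrite /eval_sum big_map scaler_sumr.
by apply: eq_bigr => p _ /=; rewrite linearZl_LR.
Qed.

Lemma tlift_pi W (b : {bilinear U -> V -> W}) s :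
  tlift b (\pi_tensor s) = eval_sum b s.
Proof.
have /eqmodP/asboolP : repr (\pi_tensor s) = s %[mod tensor] by rewrite reprK.
by apply.
Qed.

Lemma tensorP (x y : tensor) :
  (forall W (b : {bilinear U -> V -> W}), tlift b x = tlift b y) -> x = y.
Proof.
move=> xy; rewrite -(reprK x) -(reprK y); apply/eqmodP/asboolP => W b.
exact: xy.
Qed.

Let tlift0 W (b : {bilinear U -> V -> W}) : tlift b tensor_zero = 0.
Proof. by rewrite tlift_pi /eval_sum big_nil. Qed.
Let tliftD W (b : {bilinear U -> V -> W}) x y :
  tlift b (tensor_add x y) = tlift b x + tlift b y.
Proof. by rewrite tlift_pi eval_cat. Qed.
Let tliftZ W (b : {bilinear U -> V -> W}) c x :
  tlift b (tensor_scale c x) = c *: tlift b x.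
Proof. by rewrite tlift_pi eval_scale. Qed.

Let tensor_addA : associative tensor_add.
Proof. by move=> x y z; apply: tensorP => W b; rewrite !tliftD addrA. Qed.
Let tensor_addC : commutative tensor_add.
Proof. by move=> x y; apply: tensorP => W b; rewrite !tliftD addrC. Qed.
Let tensor_add0 : left_id tensor_zero tensor_add.
Proof. by move=> x; apply: tensorP => W b; rewrite tliftD tlift0 add0r. Qed.
Let tensor_addN : left_inverse tensor_zero tensor_opp tensor_add.
Proof.
by move=> x; apply: tensorP => W b; rewrite tliftD tliftZ tlift0 scaleN1r addNr.
Qed.

HB.instance Definition _ :=
  GRing.isZmodule.Build tensor tensor_addA tensor_addC tensor_add0 tensor_addN.

Let tensor_scaleA c d x :
  tensor_scale c (tensor_scale d x) = tensor_scale (c * d) x.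
Proof. by apply: tensorP => W b; rewrite !tliftZ scalerA. Qed.
Let tensor_scale1 : left_id 1 tensor_scale.
Proof. by move=> x; apply: tensorP => W b; rewrite tliftZ scale1r. Qed.
Let tensor_scaleDr : right_distributive tensor_scale +%R.
Proof.
by move=> c x y; apply: tensorP => W b; rewrite tliftZ !tliftD !tliftZ scalerDr.
Qed.
Let tensor_scaleDl x : {morph tensor_scale^~ x : c d / c + d}.
Proof.
by move=> c d; apply: tensorP => W b; rewrite tliftD !tliftZ scalerDl.
Qed.

HB.instance Definition _ := GRing.Zmodule_isLmodule.Build k tensor
  tensor_scaleA tensor_scale1 tensor_scaleDr tensor_scaleDl.

Lemma tlift_is_linear W (b : {bilinear U -> V -> W}) : linear (tlift b).
Proof. by move=> c x y; rewrite tliftD tliftZ. Qed.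
HB.instance Definition _ W b :=
  GRing.isLinear.Build k tensor W _ (tlift b) (@tlift_is_linear W b).

Lemma tlift_tpure W (b : {bilinear U -> V -> W}) u v :
  tlift b (tpure u v) = b u v.
Proof. by rewrite tlift_pi /eval_sum big_seq1. Qed.

Lemma tpure_is_bilinear : bilinear_for *:%R *:%R tpure.
Proof.
split=> [v|u] c x y; apply: tensorP => W b.
  by rewrite tlift_is_linear !tlift_tpure linearPl.
by rewrite tlift_is_linear !tlift_tpure linearPr.
Qed.
HB.instance Definition _ :=
  bilinear_isBilinear.Build k U V tensor *:%R *:%R tpure tpure_is_bilinear.

Lemma tensor_sum (x : tensor) : x = \sum_(p <- repr x) tpure p.1 p.2.
Proof.
apply: tensorP => W b; rewrite linear_sum /tlift /eval_sum.
by apply: eq_bigr => p _; rewrite -tlift_tpure.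
Qed.

Lemma tlift_unique W (g h : {linear tensor -> W}) :
  (forall u v, g (tpure u v) = h (tpure u v)) -> g =1 h.
Proof.
move=> gh x; rewrite [x]tensor_sum !linear_sum.
by apply: eq_bigr => p _; apply: gh.
Qed.

End Tensor.

Arguments tpure {k U V} u v.

Notation "U ⊗ V" := (tensor U V) (at level 40, left associativity) : type_scope.
Notation "u ⊗ₜ v" := (tpure u v) (at level 40, left associativity) : ring_scope.

Section TensorMaps.
Variable k : fieldType.

Section Map.
Variables (U V U' V' : lmodType k).
Variables (f : {linear U -> U'}) (g : {linear V -> V'}).

Definition tmap_pure (u : U) (v : V) : U' ⊗ V' := f u ⊗ₜ g v.

Lemma tmap_pure_is_bilinear : bilinear_for *:%R *:%R tmap_pure.
Proof.
by split=> [v|u] c x y; rewrite /tmap_pure linearP ?linearPl ?linearPr.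
Qed.
HB.instance Definition _ := bilinear_isBilinear.Build k U V (U' ⊗ V')
  *:%R *:%R tmap_pure tmap_pure_is_bilinear.

Definition tmap : {linear U ⊗ V -> U' ⊗ V'} := tlift tmap_pure.

Lemma tmapE u v : tmap (u ⊗ₜ v) = f u ⊗ₜ g v.
Proof. exact: tlift_tpure. Qed.

End Map.

Section Assoc.
Variables (U V W : lmodType k).

Definition tpurel (u : U) (v : V) : U ⊗ V := u ⊗ₜ v.
HB.instance Definition _ u := GRing.isLinear.Build k V (U ⊗ V) _ (tpurel u)
  ((tpure_is_bilinear U V).2 u).

Definition tpurer (w : W) (v : V) : V ⊗ W := v ⊗ₜ w.
HB.instance Definition _ w := GRing.isLinear.Build k V (V ⊗ W) _ (tpurer w)
  ((tpure_is_bilinear V W).1 w).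

Definition assocr_fun (x : U ⊗ V) (w : W) : U ⊗ (V ⊗ W) :=
  tmap idfun (tpurer w) x.
Definition assocl_fun (u : U) (y : V ⊗ W) : (U ⊗ V) ⊗ W :=
  tmap (tpurel u) idfun y.

Lemma assocr_fun_is_bilinear : bilinear_for *:%R *:%R assocr_fun.
Proof.
split=> [w|x] c y z; rewrite /assocr_fun ?linearP //.
have E w : tmap idfun (tpurer w) x = \sum_(p <- repr x) p.1 ⊗ₜ (p.2 ⊗ₜ w).
  rewrite {1}[x]tensor_sum linear_sum.
  by apply: eq_bigr => p _; rewrite tmapE.
rewrite !E /= scaler_sumr -big_split /=.
by apply: eq_bigr => p _; rewrite !linearPr.
Qed.
HB.instance Definition _ := bilinear_isBilinear.Build k (U ⊗ V) W
  (U ⊗ (V ⊗ W)) *:%R *:%R assocr_fun assocr_fun_is_bilinear.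

Lemma assocl_fun_is_bilinear : bilinear_for *:%R *:%R assocl_fun.
Proof.
split=> [y|u] c x z; rewrite /assocl_fun ?linearP //.
have E v : tmap (tpurel v) idfun y = \sum_(p <- repr y) (v ⊗ₜ p.1) ⊗ₜ p.2.
  rewrite {1}[y]tensor_sum linear_sum.
  by apply: eq_bigr => p _; rewrite tmapE.
rewrite !E /= scaler_sumr -big_split /=.
by apply: eq_bigr => p _; rewrite !linearPl.
Qed.
HB.instance Definition _ := bilinear_isBilinear.Build k U (V ⊗ W)
  ((U ⊗ V) ⊗ W) *:%R *:%R assocl_fun assocl_fun_is_bilinear.

Definition assocr : {linear (U ⊗ V) ⊗ W -> U ⊗ (V ⊗ W)} := tlift assocr_fun.
Definition assocl : {linear U ⊗ (V ⊗ W) -> (U ⊗ V) ⊗ W} := tlift assocl_fun.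

Lemma assocrE u v w : assocr ((u ⊗ₜ v) ⊗ₜ w) = u ⊗ₜ (v ⊗ₜ w).
Proof. by rewrite /assocr /= tlift_tpure /= /assocr_fun tmapE. Qed.

Lemma assoclE u v w : assocl (u ⊗ₜ (v ⊗ₜ w)) = (u ⊗ₜ v) ⊗ₜ w.
Proof. by rewrite /assocl /= tlift_tpure /= /assocl_fun tmapE. Qed.

End Assoc.

Section Mul.
Variable A : algType k.

Definition mul_fun (a b : A) : A := a * b.

Lemma mul_fun_is_bilinear : bilinear_for *:%R *:%R mul_fun.
Proof.
split=> [v|u] c x y; rewrite /mul_fun.
  by rewrite mulrDl -scalerAl.
by rewrite mulrDr -scalerAr.
Qed.
HB.instance Definition _ := bilinear_isBilinear.Build k A A A
  *:%R *:%R mul_fun mul_fun_is_bilinear.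

Definition mu : {linear A ⊗ A -> A} := tlift mul_fun.

Lemma muE a b : mu (a ⊗ₜ b) = a * b.
Proof. exact: tlift_tpure. Qed.

End Mul.

End TensorMaps.

Arguments assocr {k U V W}.
Arguments assocl {k U V W}.
Arguments mu {k A}.

Section Twisting.
Variables (k : fieldType) (A B : algType k) (tau : {linear B ⊗ A -> A ⊗ B}).

Definition is_twisting_map : Prop :=
  [/\ forall x : (B ⊗ A) ⊗ A,
        tau (tmap idfun mu (assocr x)) =
        tmap mu idfun (assocl (tmap idfun tau (assocr (tmap tau idfun x)))),
      forall x : B ⊗ (B ⊗ A),
        tau (tmap mu idfun (assocl x)) =
        tmap idfun mu (assocr (tmap tau idfun (assocl (tmap idfun tau x)))),
      forall a : A, tau (1 ⊗ₜ a) = a ⊗ₜ 1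
    & forall b : B, tau (b ⊗ₜ 1) = 1 ⊗ₜ b].

(* The composite (mu ⊗ mu) o (A ⊗ tau ⊗ B), the associators rebracketing     *)
(* (A ⊗ B) ⊗ (A ⊗ B) as A ⊗ ((B ⊗ A) ⊗ B) and A ⊗ ((A ⊗ B) ⊗ B) as            *)
(* (A ⊗ A) ⊗ (B ⊗ B).                                                        *)
Definition twisted_mul (x y : A ⊗ B) : A ⊗ B :=
  tmap mu mu (assocl (tmap idfun assocr (tmap idfun (tmap tau idfun)
    (tmap idfun assocl (assocr (x ⊗ₜ y)))))).

Lemma twisted_mulE a b a' b' :
  twisted_mul (a ⊗ₜ b) (a' ⊗ₜ b') =
  tmap mu mu (assocl (a ⊗ₜ assocr (tau (b ⊗ₜ a') ⊗ₜ b'))).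
Proof. by rewrite /twisted_mul assocrE !tmapE assoclE !tmapE. Qed.

End Twisting.

Section Involution.
Variables (k : fieldType) (M : lmodType k) (mul : M -> M -> M).

Definition is_involution (j : M -> M) : Prop :=
  [/\ linear j, forall x y, j (mul x y) = mul (j y) (j x) & involutive j].

End Involution.

Definition conj_by (A : Type) (star phi : A -> A) (a : A) : A :=
  star (phi (star a)).

Definition left_twisted_derivation (k : fieldType) (A : algType k)
    (f delta : A -> A) : Prop :=
  forall a b, delta (a * b) = delta a * b + f a * delta b.

Definition lifts_compatibly (k : fieldType) (A B : algType k)
    (tau : {linear B ⊗ A -> A ⊗ B}) (star : A -> A) (bar : B -> B) : Prop :=
  exists j : A ⊗ B -> A ⊗ B,
    [/\ is_involution (twisted_mul tau) j,
        forall a, j (a ⊗ₜ 1) = star a ⊗ₜ 1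
      & forall z, j (1 ⊗ₜ z) = 1 ⊗ₜ bar z].

(* Main.v *)
Require Import Defs.
From HB Require Import structures.
From mathcomp Require Import all_boot all_order all_algebra all_field.

Set Implicit Arguments.
Unset Strict Implicit.
Unset Printing Implicit Defensive.

Import GRing.Theory.
Local Open Scope ring_scope.

(** A compatible involution [j] has no freedom: since [a ⊗ z] is the product
    [(a ⊗ 1)(1 ⊗ z)], antimultiplicativity forces
    [j (a ⊗ z) = (1 ⊗ bar z)(star a ⊗ 1) = tau (bar z ⊗ star a)].  So the
    question is only when this linear map, [lift_invol], is an antimultiplicative
    involution.

    The first point is that antimultiplicativity comes for free once
    [lift_invol] is involutive, for any twisting map between algebras with
    involution ([lifts_compatiblyP]).  The twisted tensor product being
    associative ([twisted_mulA]), write [(a ⊗ z)(b ⊗ w) = a (z b) w], where the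
    outer factors [a] and [w] are reversed by [lift_invol] because [tau]
    respects both multiplications.  The middle factor
    [z b = tau (z ⊗ b) = lift_invol (star b ⊗ bar z)] is sent to
    [star b ⊗ bar z] exactly by involutivity.

    The second point is to test involutivity for [l = k(eta)].  As [(1, eta)] is
    a basis of [l], it is enough to look at [a ⊗ 1], where it always holds, and
    at [a ⊗ eta].  Since [tau (eta ⊗ a) = delta a ⊗ 1 + f a ⊗ eta] and
    [eta] is sent to [- eta], applying [lift_invol] twice to [a ⊗ eta] gives
    [(delta (star (f (star a))) - star (delta (star a))) ⊗ 1
     + f (star (f (star a))) ⊗ eta].
    Comparing coordinates with [0 ⊗ 1 + a ⊗ eta] yields the two conditions. *)

(** The universal property only compares linear maps; induction on sums of pure
    tensors also reaches identities between values of several maps. *)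
Lemma tensor_ind (k : fieldType) (U V : lmodType k) (P : U ⊗ V -> Prop) :
  P 0 -> (forall x y, P x -> P y -> P (x + y)) -> (forall u v, P (u ⊗ₜ v)) ->
  forall x, P x.
Proof.
move=> P0 PD Pt x; rewrite [x]tensor_sum.
exact: (big_ind P).
Qed.

(** * The twisted tensor product is an associative algebra *)

Section TwistedProduct.
Variables (k : fieldType) (A B : algType k) (tau : {linear B ⊗ A -> A ⊗ B}).
Implicit Types (a : A) (b : B) (x y z t : A ⊗ B).

Local Notation tmul := (twisted_mul tau).
Local Infix "·" := tmul (at level 40, left associativity).

Lemma twisted_mul_is_bilinear : bilinear_for *:%R *:%R tmul.
Proof.
split=> [y|x] c u v; rewrite /twisted_mul ?linearPl ?linearPr !linearP //.
Qed.
HB.instance Definition _ := bilinear_isBilinear.Build k (A ⊗ B) (A ⊗ B) (A ⊗ B)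
  *:%R *:%R tmul twisted_mul_is_bilinear.

Lemma twisted_mulDl x y z : (x + y) · z = x · z + y · z.
Proof. exact: linearDl. Qed.
Lemma twisted_mulDr x y z : z · (x + y) = z · x + z · y.
Proof. exact: linearDr. Qed.
Lemma twisted_mul0 x : x · 0 = 0.
Proof. exact: linear0r. Qed.
Lemma twisted_0mul x : 0 · x = 0.
Proof. exact: linear0l. Qed.

(** In the twisted product this is [(a ⊗ 1) t (1 ⊗ b)], but its formula does not
    involve [tau]: the twisting acts only on adjacent factors of [B] and [A],
    which do not occur here. *)
Definition sandwich a t b : A ⊗ B := tmap mu mu (assocl (a ⊗ₜ assocr (t ⊗ₜ b))).

Lemma sandwichE a p q b : sandwich a (p ⊗ₜ q) b = (a * p) ⊗ₜ (q * b).
Proof. by rewrite /sandwich assocrE assoclE tmapE !muE. Qed.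

Lemma sandwich0 a b : sandwich a 0 b = 0.
Proof. by rewrite /sandwich linear0l linear0 linear0r !linear0. Qed.

Lemma sandwichD a s t b :
  sandwich a (s + t) b = sandwich a s b + sandwich a t b.
Proof. by rewrite /sandwich linearDl linearD linearDr !linearD. Qed.

Lemma twisted_mul_pure a b a' b' :
  (a ⊗ₜ b) · (a' ⊗ₜ b') = sandwich a (tau (b ⊗ₜ a')) b'.
Proof. exact: twisted_mulE. Qed.

Hypothesis tauP : is_twisting_map tau.

Let tau_unitl a : tau (1 ⊗ₜ a) = a ⊗ₜ 1. Proof. by case: tauP. Qed.
Let tau_unitr b : tau (b ⊗ₜ 1) = 1 ⊗ₜ b. Proof. by case: tauP. Qed.

Lemma twisted_mul_left a a' b' : (a ⊗ₜ 1) · (a' ⊗ₜ b') = (a * a') ⊗ₜ b'.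
Proof. by rewrite twisted_mul_pure tau_unitl sandwichE mul1r. Qed.

Lemma twisted_mul_right a b b' : (a ⊗ₜ b) · (1 ⊗ₜ b') = a ⊗ₜ (b * b').
Proof. by rewrite twisted_mul_pure tau_unitr sandwichE mulr1. Qed.

Lemma twisted_mul_swap b a : (1 ⊗ₜ b) · (a ⊗ₜ 1) = tau (b ⊗ₜ a).
Proof.
rewrite twisted_mul_pure; elim/tensor_ind: (tau _) => [|s t IHs IHt|u v].
- by rewrite sandwich0.
- by rewrite sandwichD IHs IHt.
- by rewrite sandwichE mul1r mulr1.
Qed.

Lemma twisted_mul_split a b : (a ⊗ₜ 1) · (1 ⊗ₜ b) = a ⊗ₜ b.
Proof. by rewrite twisted_mul_left mulr1. Qed.

(** The first hexagon of a twisting map, read inside the product: moving [b] past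
    [a * a'] is moving it past [a], then past [a']. *)
Lemma tau_mulr b a a' : tau (b ⊗ₜ (a * a')) = tau (b ⊗ₜ a) · (a' ⊗ₜ 1).
Proof.
have [/(_ ((b ⊗ₜ a) ⊗ₜ a')) + _ _ _] := tauP.
rewrite assocrE !tmapE muE /= => ->.
elim/tensor_ind: (tau _) => [|x y IHx IHy|u v].
- by rewrite linear0l !linear0 twisted_0mul.
- by rewrite linearDl !linearD /= IHx IHy twisted_mulDl.
rewrite assocrE tmapE twisted_mul_pure /=.
elim/tensor_ind: (tau _) => [|s t IHs IHt|p q].
- by rewrite linear0r !linear0 sandwich0.
- by rewrite linearDr !linearD /= IHs IHt sandwichD.
- by rewrite assoclE tmapE muE sandwichE mulr1.
Qed.

(** The second hexagon, read in the same way. *)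
Lemma tau_mull b b' a : tau ((b * b') ⊗ₜ a) = (1 ⊗ₜ b) · tau (b' ⊗ₜ a).
Proof.
have [_ /(_ (b ⊗ₜ (b' ⊗ₜ a))) + _ _] := tauP.
rewrite assoclE !tmapE muE /= => ->.
elim/tensor_ind: (tau _) => [|x y IHx IHy|u v].
- by rewrite linear0r !linear0 twisted_mul0.
- by rewrite linearDr !linearD /= IHx IHy twisted_mulDr.
rewrite assoclE tmapE twisted_mul_pure /=.
elim/tensor_ind: (tau _) => [|s t IHs IHt|p q].
- by rewrite linear0l !linear0 sandwich0.
- by rewrite linearDl !linearD /= IHs IHt sandwichD.
- by rewrite assocrE tmapE muE sandwichE mul1r.
Qed.

Lemma twisted_mulA_left a x y : (a ⊗ₜ 1) · (x · y) = ((a ⊗ₜ 1) · x) · y.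
Proof.
elim/tensor_ind: x => [|x x' IHx IHx'|p q].
- by rewrite !(twisted_0mul, twisted_mul0).
- by rewrite !(twisted_mulDl, twisted_mulDr) IHx IHx'.
elim/tensor_ind: y => [|y y' IHy IHy'|r s].
- by rewrite !(twisted_0mul, twisted_mul0).
- by rewrite !(twisted_mulDl, twisted_mulDr) IHy IHy'.
rewrite twisted_mul_left !twisted_mul_pure.
elim/tensor_ind: (tau _) => [|t t' IHt IHt'|u v].
- by rewrite !sandwich0 twisted_mul0.
- by rewrite !sandwichD twisted_mulDr IHt IHt'.
- by rewrite !sandwichE twisted_mul_left mulrA.
Qed.

Lemma twisted_mulA_right b x y : x · (y · (1 ⊗ₜ b)) = (x · y) · (1 ⊗ₜ b).
Proof.
elim/tensor_ind: x => [|x x' IHx IHx'|p q].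
- by rewrite !(twisted_0mul, twisted_mul0).
- by rewrite !(twisted_mulDl, twisted_mulDr) IHx IHx'.
elim/tensor_ind: y => [|y y' IHy IHy'|r s].
- by rewrite !(twisted_0mul, twisted_mul0).
- by rewrite !(twisted_mulDl, twisted_mulDr) IHy IHy'.
rewrite twisted_mul_right !twisted_mul_pure.
elim/tensor_ind: (tau _) => [|t t' IHt IHt'|u v].
- by rewrite !sandwich0 twisted_0mul.
- by rewrite !sandwichD twisted_mulDl IHt IHt'.
- by rewrite !sandwichE twisted_mul_right mulrA.
Qed.

(** Associativity when the middle factor comes from [B] and the right one from
    [A]; on a pure tensor [p ⊗ q] it is the rule for moving [q * b] past [a]. *)
Lemma mul_tau_r x b a :
  (x · (1 ⊗ₜ b)) · (a ⊗ₜ 1) = x · tau (b ⊗ₜ a).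
Proof.
elim/tensor_ind: x => [|x x' IHx IHx'|p q].
- by rewrite !twisted_0mul.
- by rewrite !twisted_mulDl IHx IHx'.
rewrite twisted_mul_right -twisted_mul_split -twisted_mulA_left twisted_mul_swap.
by rewrite tau_mull twisted_mulA_left twisted_mul_split.
Qed.

(** The mirror image of [mul_tau_r], from the rule for moving [b] past a product
    in [A]. *)
Lemma mul_tau_l b a y :
  (1 ⊗ₜ b) · ((a ⊗ₜ 1) · y) = tau (b ⊗ₜ a) · y.
Proof.
elim/tensor_ind: y => [|y y' IHy IHy'|p q].
- by rewrite !twisted_mul0.
- by rewrite !twisted_mulDr IHy IHy'.
rewrite twisted_mul_left -twisted_mul_split twisted_mulA_right twisted_mul_swap.
by rewrite tau_mulr -twisted_mulA_right twisted_mul_split.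
Qed.

(** Outer factors from [A] on the left and from [B] on the right can be
    stripped off, leaving [1 ⊗ b], [a' ⊗ b'] and [a'' ⊗ 1]; both bracketings of
    these are [tau (b ⊗ a') · tau (b' ⊗ a'')]. *)
Lemma twisted_mulA x y z : x · (y · z) = (x · y) · z.
Proof.
elim/tensor_ind: x => [|x x' IHx IHx'|a b].
- by rewrite !twisted_0mul.
- by rewrite !twisted_mulDl IHx IHx'.
elim/tensor_ind: z => [|z z' IHz IHz'|a'' b''].
- by rewrite !twisted_mul0.
- by rewrite !twisted_mulDr IHz IHz'.
rewrite -(twisted_mul_split a b) -(twisted_mul_split a'' b'').
(* Strip off a ⊗ 1 on the left and 1 ⊗ b'' on the right. *)
rewrite !twisted_mulA_right -!twisted_mulA_left; do 2!congr (_ · _).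
elim/tensor_ind: y => [|y y' IHy IHy'|a' b'].
- by rewrite !(twisted_0mul, twisted_mul0).
- by rewrite !(twisted_mulDl, twisted_mulDr) IHy IHy'.
rewrite -(twisted_mul_split a' b') mul_tau_r mul_tau_l.
by rewrite twisted_mulA_right twisted_mul_swap mul_tau_r.
Qed.

(** * Lifting involutions to a twisted tensor product *)

Section Lift.
Variables (star : {linear A -> A}) (bar : {linear B -> B}).
Hypotheses (starM : {morph star : a a' / a * a' >-> a' * a})
           (barM : {morph bar : b b' / b * b' >-> b' * b})
           (starK : involutive star) (barK : involutive bar).

Lemma antimorphism1 (C : algType k) (s : C -> C) :
  {morph s : u v / u * v >-> v * u} -> involutive s -> s 1 = 1.
Proof. by move=> sM sK; rewrite -[LHS]mulr1 -{2}(sK 1) -sM mulr1 sK. Qed.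

(** The value on pure tensors that any compatible involution must take; see
    [compatible_lift_unique]. *)
Definition lift_invol_pure a b : A ⊗ B := tau (bar b ⊗ₜ star a).

Lemma lift_invol_pure_is_bilinear : bilinear_for *:%R *:%R lift_invol_pure.
Proof.
split=> [v|u] c x y; rewrite /lift_invol_pure linearP.
  by rewrite linearPr linearP.
by rewrite linearPl linearP.
Qed.
HB.instance Definition _ := bilinear_isBilinear.Build k A B (A ⊗ B)
  *:%R *:%R lift_invol_pure lift_invol_pure_is_bilinear.

Definition lift_invol : {linear A ⊗ B -> A ⊗ B} := tlift lift_invol_pure.

Lemma lift_involE a b : lift_invol (a ⊗ₜ b) = tau (bar b ⊗ₜ star a).
Proof. exact: tlift_tpure. Qed.

Lemma lift_invol_left a : lift_invol (a ⊗ₜ 1) = star a ⊗ₜ 1.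
Proof. by rewrite lift_involE (antimorphism1 barM barK) tau_unitl. Qed.

Lemma lift_invol_right b : lift_invol (1 ⊗ₜ b) = 1 ⊗ₜ bar b.
Proof. by rewrite lift_involE (antimorphism1 starM starK) tau_unitr. Qed.

(** Factors of [A] on the left and of [B] on the right never have to cross one
    another, so for them reversal of products is inherited from [star] and [bar]
    through [tau_mulr] and [tau_mull]. *)
Lemma lift_invol_outer a x b :
  lift_invol ((a ⊗ₜ 1) · x · (1 ⊗ₜ b)) =
  (1 ⊗ₜ bar b) · lift_invol x · (star a ⊗ₜ 1).
Proof.
elim/tensor_ind: x => [|x y IHx IHy|p q].
- by rewrite !(twisted_0mul, twisted_mul0, linear0).
- by rewrite !(twisted_mulDl, twisted_mulDr, linearD) /= IHx IHy.
rewrite twisted_mul_left twisted_mul_right !lift_involE.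
by rewrite starM barM tau_mulr tau_mull.
Qed.

(** What [lift_invol_outer] leaves open is the product of [1 ⊗ b] and [a' ⊗ 1] in
    the wrong order, that is [tau (b ⊗ a')]; but this is itself a value of
    [lift_invol], so involutivity computes its image. *)
Lemma lift_invol_antimult : involutive lift_invol ->
  forall x y, lift_invol (x · y) = lift_invol y · lift_invol x.
Proof.
move=> lift_involK x y.
elim/tensor_ind: x => [|x x' IHx IHx'|a b].
- by rewrite !(twisted_0mul, twisted_mul0, linear0).
- by rewrite !(twisted_mulDl, twisted_mulDr, linearD) /= IHx IHx'.
elim/tensor_ind: y => [|y y' IHy IHy'|a' b'].
- by rewrite !(twisted_0mul, twisted_mul0, linear0).
- by rewrite !(twisted_mulDl, twisted_mulDr, linearD) /= IHy IHy'.
have lift_invol_tau : lift_invol (tau (b ⊗ₜ a')) = star a' ⊗ₜ bar b.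
  by rewrite -[b in LHS]barK -[a' in LHS]starK -lift_involE lift_involK.
rewrite -(twisted_mul_split a b) -(twisted_mul_split a' b').
(* Bracket a b a' b' as a (b a') b'. *)
rewrite twisted_mulA -(twisted_mulA (a ⊗ₜ 1)) twisted_mul_swap lift_invol_outer.
rewrite lift_invol_tau -[star a' ⊗ₜ _]twisted_mul_split [in RHS]twisted_mul_split.
by rewrite [in RHS]twisted_mul_split !lift_involE -!twisted_mul_swap !twisted_mulA.
Qed.

Lemma compatible_lift_unique (j : A ⊗ B -> A ⊗ B) :
  is_involution tmul j -> (forall a, j (a ⊗ₜ 1) = star a ⊗ₜ 1) ->
  (forall b, j (1 ⊗ₜ b) = 1 ⊗ₜ bar b) -> j =1 lift_invol.
Proof.
move=> [jlin jM _] jA jB x.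
have jD u v : j (u + v) = j u + j v by rewrite -[u in LHS]scale1r jlin scale1r.
elim/tensor_ind: x => [|x y IHx IHy|a b].
- by apply: (addrI (j 0)); rewrite -jD linear0 !addr0.
- by rewrite jD linearD IHx IHy.
by rewrite -twisted_mul_split jM jA jB twisted_mul_swap twisted_mul_split lift_involE.
Qed.

(** Involutivity of the only candidate is the whole obstruction to lifting. *)
Theorem lifts_compatiblyP :
  lifts_compatibly tau star bar <-> involutive lift_invol.
Proof.
split=> [[j [jinv jA jB]] x | lift_involK].
  have jE := compatible_lift_unique jinv jA jB.
  by case: jinv => _ _ jK; rewrite -!jE jK.
exists lift_invol.
split; [split=> // | exact: lift_invol_left | exact: lift_invol_right].
- exact: linearP.
- exact: lift_invol_antimult.
Qed.

End Lift.
End TwistedProduct.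

(** * Tensors over a quadratic extension *)

Section QuadraticExtension.
Variables (k : fieldType) (l : fieldExtType k) (eta : l).
Hypotheses (l_quadratic : \dim {:l} = 2%N) (l_gen : <<1; eta>>%VS = {:l}%VS).

(* With eta first, freeness of X says that eta is not in the base field. *)
Let X := [tuple eta; 1 : l].

Lemma basis_eta_1 : basis_of {:l} X.
Proof.
rewrite basisEfree subvf l_quadratic andbT free_cons seq1_free oner_neq0 andbT.
rewrite span_seq1; apply/negP => /Fadjoin_idP eta1.
by have := l_quadratic; rewrite -l_gen eta1 dimv1.
Qed.

Lemma decompose_eta z : exists c d : k, z = c *: 1 + d *: eta.
Proof.
rewrite (coord_basis basis_eta_1 (memvf z)) big_ord_recl big_ord1 addrC.
by exists (coord X (lift ord0 ord0) z), (coord X ord0 z).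
Qed.

Lemma eq_linear_tensor (A W : lmodType k) (g h : {linear A ⊗ l -> W}) :
  (forall a, g (a ⊗ₜ 1) = h (a ⊗ₜ 1)) ->
  (forall a, g (a ⊗ₜ eta) = h (a ⊗ₜ eta)) -> g =1 h.
Proof.
move=> gh1 gh_eta; apply: tlift_unique => a z.
have [c [d ->]] := decompose_eta z.
by rewrite linearDr !linearZr_LR !linearD !linearZ /= gh1 gh_eta.
Qed.

(** The [i]-th coordinate map [A ⊗ l -> A] of the basis [X], before it is extended
    from pairs to tensors. *)
Definition contract (A : lmodType k) (i : 'I_2) (a : A) (z : l) : A :=
  coord X i z *: a.

Lemma contract_is_bilinear (A : lmodType k) i :
  bilinear_for *:%R *:%R (@contract A i).
Proof.
split=> [z|a] c x y; rewrite /contract.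
  by rewrite /= scalerDr !scalerA mulrC.
by rewrite linearP /= scalerDl -scalerA.
Qed.
HB.instance Definition _ (A : lmodType k) i := bilinear_isBilinear.Build
  k A l A *:%R *:%R (@contract A i) (contract_is_bilinear A i).

Lemma tensor_eta_inj (A : lmodType k) (a b a' b' : A) :
  a ⊗ₜ 1 + b ⊗ₜ eta = a' ⊗ₜ 1 + b' ⊗ₜ eta -> a = a' /\ b = b'.
Proof.
have freeX : free X by apply: basis_free basis_eta_1.
have coord1 i : coord X i 1 = (1 == i)%:R := coord_free 1 i freeX.
have coord_eta i : coord X i eta = (0 == i)%:R := coord_free 0 i freeX.
have contractE i (u v : A) : tlift (@contract A i) (u ⊗ₜ 1 + v ⊗ₜ eta) =
    (1 == i)%:R *: u + (0 == i)%:R *: v.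
  by rewrite linearD /= !tlift_tpure /= /contract coord1 coord_eta.
move=> /[dup] /(congr1 (tlift (@contract A 1))) +
  /(congr1 (tlift (@contract A 0))).
by rewrite !contractE /= !scale0r !scale1r !add0r !addr0.
Qed.

End QuadraticExtension.

(** * Compatible involutions over a quadratic extension *)

Theorem proposition1p8 (k : fieldType) (char_k : 2%N \notin [pchar k])
  (A : algType k) (star : A -> A)
  (star_invol : is_involution ( *%R) star)
  (l : fieldExtType k) (eta : l)
  (l_quadratic : \dim {:l} = 2%N) (l_gen : <<1; eta>>%VS = {:l}%VS)
  (sigma : 'End(l)) (sigma_aut : kAut 1 {:l} sigma)
  (sigma_nontrivial : sigma <> \1%VF) (sigma_eta : sigma eta = - eta)
  (f : {lrmorphism A -> A}) (delta : {linear A -> A})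
  (delta_der : left_twisted_derivation f delta)
  (tau : {linear l ⊗ A -> A ⊗ l})
  (tau_twisting : is_twisting_map tau)
  (tau_induced : forall a : A, tau (eta ⊗ₜ a) = delta a ⊗ₜ 1 + f a ⊗ₜ eta) :
  lifts_compatibly tau star sigma <->
  (f \o conj_by star f =1 id /\
   delta \o conj_by star f =1 conj_by star delta).
Proof.
have [star_lin starM starK] := star_invol.
(* The involution of A is given as a bare function; package its linearity. *)
pose star_spec := GRing.isLinear.Build k A A _ star star_lin.
pose starL : {linear A -> A} := HB.pack star star_spec.
have /andP[/kHomP[sigmaM sigma_fix] _] := sigma_aut.
have sigma1 : sigma 1 = 1 by rewrite sigma_fix ?mem1v.
have sigma_anti : {morph sigma : z w / z * w >-> w * z}.
  by move=> z w; rewrite sigmaM ?memvf // mulrC.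
have sigmaK : involutive sigma.
  move=> z; have [c [d ->]] := decompose_eta l_quadratic l_gen z.
  rewrite !linearD !linearZ /= !sigma1 sigma_eta.
  by rewrite linearN /= sigma_eta opprK.
have starN : {morph star : a / - a} by exact: (raddfN starL).
rewrite (lifts_compatiblyP tau_twisting (star := starL) (bar := sigma)) //.
have lift_invol_1 a : lift_invol tau starL sigma (a ⊗ₜ 1) = star a ⊗ₜ 1.
  exact: lift_invol_left.
have lift_invol_eta a : lift_invol tau starL sigma (a ⊗ₜ eta) =
    (- delta (star a)) ⊗ₜ 1 + (- f (star a)) ⊗ₜ eta.
  by rewrite lift_involE /= sigma_eta linearNl linearN /= tau_induced opprD !linearNl.
have lift_invol2_eta a :
    lift_invol tau starL sigma (lift_invol tau starL sigma (a ⊗ₜ eta)) =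
    (delta (star (f (star a))) - star (delta (star a))) ⊗ₜ 1
    + f (star (f (star a))) ⊗ₜ eta.
  rewrite lift_invol_eta linearD /= lift_invol_1 lift_invol_eta.
  by rewrite !starN !linearN !opprK addrA -linearDl [- _ + _]addrC.
split=> [lift_involK | [ffbar dfbar]].
  suff coords a : f (star (f (star a))) = a /\
             delta (star (f (star a))) = star (delta (star a)).
    by split=> a; case: (coords a).
  (* Compare coordinates in 0 ⊗ 1 + a ⊗ eta. *)
  have := lift_invol2_eta a; rewrite lift_involK -[LHS]add0r.
  rewrite -(linear0l (@tpure k A l) 1).
  case/(tensor_eta_inj l_quadratic l_gen) => /esym/eqP + <-.
  by rewrite subr_eq0 => /eqP.
apply: (eq_linear_tensor l_quadratic l_gen (h := idfun)
          (g := lift_invol _ _ _ \o lift_invol _ _ _)) => a /=.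
  by rewrite !lift_invol_1 starK.
rewrite lift_invol2_eta.
have /= -> := ffbar a; have /= -> := dfbar a.
by rewrite subrr linear0l add0r.
Qed.
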